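(* Let $\varphi:[0,1]\to\mathbb{R}^d$ be a Lipschitz function with Lipschitz constant $L_\varphi$, let $\delta>0$ and $0<\varepsilon<1$. Let $\mathcal{N}$ be a positive integer with $$\mathcal{N}\ge4\cdot\frac{L_\varphi\,(\sqrt d+2)}{\delta\,\varepsilon}.$$ Let $k\le d$ and let $M\in\mathbb{R}^{k\times d}$ be a random matrix generated according to (S2) or (S3) (see context). Let $p\in[0,1]$ and suppose that $k$ is such that, for every choice of $\mathcal{N}$ points $z_1,\dots,z_{\mathcal{N}}\in\mathbb{R}^d$, with probability at least $p$ the matrix $M$ satisfies the (strong) Johnson--Lindenstrauss property of parameter $\tilde\varepsilon=\varepsilon/2$ at all the points $z_1,\dots,z_{\mathcal{N}}$. Then, with probability at least $p$, the matrix $M$ fulfills the weak Johnson--Lindenstrauss property of parameters $\varepsilon$ and $\delta$ at $\varphi(t)$ for every $t\in[0,1]$, i.e. for all $t\in[0,1]$ either $$(1-\varepsilon)\|\varphi(t)\|\le\|M\varphi(t)\|\le(1+\varepsilon)\|\varphi(t)\|$$ or $$\|\varphi(t)\|\le\delta\quad\text{and}\quad\|M\varphi(t)\|\le\delta.$$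
   Context: $\|\cdot\|$ is the Euclidean norm. For $\varepsilon\in(0,1)$, $M\in\mathbb{R}^{k\times d}$ has the (strong) Johnson--Lindenstrauss property of parameter $\varepsilon$ at $z\in\mathbb{R}^d$ if $(1-\varepsilon)\|z\|\le\|Mz\|\le(1+\varepsilon)\|z\|$. The Lipschitz constant is $L_\varphi=\sup_{t\ne s}\|\varphi(t)-\varphi(s)\|/|t-s|$. Random matrices: (S2) the entries of $M\in\mathbb{R}^{k\times d}$ are independent, each equal to $+1/\sqrt k$ or $-1/\sqrt k$ with probability $1/2$. (S3) $M=\sqrt{d/k}\,P$, where $P\in\mathbb{R}^{k\times d}$ is a random projection, i.e. $P$ has orthonormal rows ($PP^{T}=I_k$) spanning a uniformly distributed random $k$-dimensional subspace of $\mathbb{R}^d$. *)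

(* Defs.v *)
From mathcomp Require Import all_boot all_order all_algebra.
From mathcomp Require Import all_classical all_reals all_analysis.
Import Order.TTheory GRing.Theory Num.Theory.
Import numFieldNormedType.Exports.

Set Implicit Arguments.
Unset Strict Implicit.
Unset Printing Implicit Defensive.

Local Open Scope classical_set_scope.
Local Open Scope ring_scope.

(* MathComp-Analysis equips 'cV[R]_n with the sup norm, hence this definition. *)
Definition norm2 {R : realType} {n : nat} (x : 'cV[R]_n) : R :=
  Num.sqrt (\sum_(i < n) x i ord0 ^+ 2).

Definition strong_JL {R : realType} {k d : nat} (eps : R) (M : 'M[R]_(k, d))
    (z : 'cV[R]_d) : Prop :=
  (1 - eps) * norm2 z <= norm2 (M *m z) <= (1 + eps) * norm2 z.

Definition weak_JL {R : realType} {k d : nat} (eps delta : R)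
    (M : 'M[R]_(k, d)) (z : 'cV[R]_d) : Prop :=
  strong_JL eps M z \/ norm2 z <= delta /\ norm2 (M *m z) <= delta.

(* A map [0, 1] -> R^d is represented by a function on R whose values outside
   of [0, 1] are never used. *)
Definition lipschitz01 {R : realType} {d : nat} (phi : R -> 'cV[R]_d) : Prop :=
  exists L : R, forall t s : R, 0 <= t <= 1 -> 0 <= s <= 1 ->
    norm2 (phi t - phi s) <= L * `|t - s|.

(* [sup] is a real supremum: meaningful when [lipschitz01 phi] holds, since the
   set is then bounded above (and it is never empty). *)
Definition lipschitz_const {R : realType} {d : nat} (phi : R -> 'cV[R]_d) : R :=
  sup [set q | exists t s : R, [/\ 0 <= t <= 1, 0 <= s <= 1, t != s &
                 q = norm2 (phi t - phi s) / `|t - s|]].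

(* Matrices with the Borel sigma-algebra. *)
Notation mxBorel R m n := (g_sigma_algebraType (@open 'M[R]_(m, n))).

(* Measurability is part of the notion: a measure has no prescribed value on
   non-measurable sets. *)
Definition with_prob_ge {disp : measure_display} {T : measurableType disp}
    {R : realType} (P : probability T R) (p : R) (E : set T) : Prop :=
  measurable E /\ (p%:E <= P E)%E.

Definition mutually_independent {disp disp' : measure_display}
    {T : measurableType disp} {T' : measurableType disp'} {R : realType}
    (P : probability T R) {I : finType} (X : I -> T -> T') : Prop :=
  forall (J : {set I}) (A : I -> set T'),
    (forall i, i \in J -> measurable (A i)) ->
    P (\bigcap_(i in [set` J]) X i @^-1` A i) =
    (\prod_(i in J) P (X i @^-1` A i))%E.

Definition random_sign_matrix {disp : measure_display}
    {T : measurableType disp} {R : realType} (P : probability T R) {k d : nat}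
    (M : {RV P >-> mxBorel R k d}) : Prop :=
  mutually_independent P
    (fun (ij : 'I_k * 'I_d) (w : T) => (M w : 'M[R]_(k, d)) ij.1 ij.2) /\
  forall (i : 'I_k) (j : 'I_d),
    P [set w | (M w : 'M[R]_(k, d)) i j = (Num.sqrt k%:R)^-1] = (2^-1)%:E /\
    P [set w | (M w : 'M[R]_(k, d)) i j = - (Num.sqrt k%:R)^-1] = (2^-1)%:E.

(* If the rows of Q are orthonormal, then Q^T Q is the orthogonal projector of
   R^d onto their span.  Identifying a subspace with its projector embeds the
   Grassmannian of k-dimensional subspaces into the d x d matrices, with its
   usual topology. *)
Definition row_space_projector {R : realType} {k d : nat} (Q : 'M[R]_(k, d)) :
    'M[R]_d := Q^T *m Q.

(* The uniform distribution on the Grassmannian is the rotation-invariant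
   probability distribution; for U orthogonal, the rows of Q U span the image
   under the rotation x |-> x U of the row space of Q. *)
Definition uniform_row_space {disp : measure_display}
    {T : measurableType disp} {R : realType} (P : probability T R) {k d : nat}
    (Q : {RV P >-> mxBorel R k d}) : Prop :=
  forall U : 'M[R]_d, U *m U^T = 1%:M ->
  forall B : set (mxBorel R d d), measurable B ->
    P [set w | B (row_space_projector ((Q w : 'M[R]_(k, d)) *m U))] =
    P [set w | B (row_space_projector (Q w : 'M[R]_(k, d)))].

Definition random_projection {disp : measure_display}
    {T : measurableType disp} {R : realType} (P : probability T R) {k d : nat}
    (Q : {RV P >-> mxBorel R k d}) : Prop :=
  {ae P, forall w, (Q w : 'M[R]_(k, d)) *m (Q w : 'M[R]_(k, d))^T = 1%:M} /\
  uniform_row_space Q.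

Definition scaled_random_projection {disp : measure_display}
    {T : measurableType disp} {R : realType} (P : probability T R) {k d : nat}
    (M : {RV P >-> mxBorel R k d}) : Prop :=
  exists Q : {RV P >-> mxBorel R k d}, random_projection Q /\
    forall w, (M w : 'M[R]_(k, d)) =
      Num.sqrt (d%:R / k%:R) *: (Q w : 'M[R]_(k, d)).

(* Main.v *)
(** Both laws give [M] the Frobenius norm [sqrt d] almost surely, whence
    [norm2 (M *m x) <= sqrt d * norm2 x].  Apply the hypothesis at the points
    [phi (i / N)] with [i < N].  Every [phi t] is within [L / N] of one of them,
    and [(sqrt d + 2) * L / N <= delta * eps / 4]; replacing the grid point by
    [phi t] thus costs at most [eps / 2 * norm2 (phi t)] when
    [norm2 (phi t) >= delta / 2], and otherwise both norms are at most [delta].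
    The target event is measurable although it ranges over uncountably many
    [t], because the weak JL property is a closed condition on the matrix. *)

Require Import Defs.
From mathcomp Require Import all_boot all_order all_algebra.
From mathcomp Require Import all_classical all_reals all_analysis.
From mathcomp Require Import ring lra.
Import Order.TTheory GRing.Theory Num.Theory.
Import numFieldNormedType.Exports.

Local Open Scope classical_set_scope.
Local Open Scope ring_scope.

(** By Lagrange's identity, twice the gap between the two sides is a sum of squares. *)
Lemma Cauchy_Schwarz_sum {R : realType} {I : finType} (a b : I -> R) :
  (\sum_i a i * b i) ^+ 2 <= (\sum_i a i ^+ 2) * (\sum_i b i ^+ 2).
Proof.
have lagrange : \sum_i \sum_j (a i * b j - a j * b i) ^+ 2 =
    2 * ((\sum_i a i ^+ 2) * (\sum_i b i ^+ 2) - (\sum_i a i * b i) ^+ 2).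
  (* In this shape each product expands into a double sum over [i] and [j], and the identity can be
     checked term by term. *)
  have -> : 2 * ((\sum_i a i ^+ 2) * (\sum_i b i ^+ 2) - (\sum_i a i * b i) ^+ 2)
      = (\sum_i a i ^+ 2) * (\sum_i b i ^+ 2)
        + (\sum_i b i ^+ 2) * (\sum_i a i ^+ 2)
        - (\sum_i a i * b i) * (2 * (\sum_i a i * b i)) by ring.
  rewrite [2 * _]mulr_sumr !big_distrlr/= -big_split/= -sumrB.
  apply: eq_bigr => i _; rewrite -big_split/= -sumrB.
  by apply: eq_bigr => j _; ring.
rewrite -subr_ge0 -(@pmulr_rge0 _ 2)// -lagrange.
by apply: sumr_ge0 => i _; apply: sumr_ge0 => j _; exact: sqr_ge0.
Qed.

Section norm2.
Context {R : realType}.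
Implicit Types n k d : nat.

Lemma norm2_ge0 {n} (x : 'cV[R]_n) : 0 <= norm2 x.
Proof. exact: sqrtr_ge0. Qed.

Lemma sqr_norm2 {n} (x : 'cV[R]_n) : norm2 x ^+ 2 = \sum_i x i ord0 ^+ 2.
Proof. by rewrite sqr_sqrtr// sumr_ge0// => i _; exact: sqr_ge0. Qed.

Lemma norm2_0 n : norm2 (0 : 'cV[R]_n) = 0.
Proof.
by rewrite /norm2 big1 ?sqrtr0// => i _; rewrite mxE expr0n.
Qed.

Lemma norm2N {n} (x : 'cV[R]_n) : norm2 (- x) = norm2 x.
Proof. by congr Num.sqrt; apply: eq_bigr => i _; rewrite mxE sqrrN. Qed.

Lemma norm2D {n} (x y : 'cV[R]_n) : norm2 (x + y) <= norm2 x + norm2 y.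
Proof.
rewrite -(@ler_pXn2r _ 2)// ?nnegrE ?addr_ge0 ?norm2_ge0// sqrrD !sqr_norm2.
under eq_bigr do rewrite mxE sqrrD.
rewrite !big_split/= lerD2r lerD2l -mulr2n lerMn2r/=.
apply: le_trans (ler_norm _) _.
rewrite -(@ler_pXn2r _ 2)// ?nnegrE ?mulr_ge0 ?norm2_ge0//.
by rewrite real_normK ?num_real// exprMn !sqr_norm2 Cauchy_Schwarz_sum.
Qed.

(** Cauchy-Schwarz on each row. The Frobenius norm is a convenient bound on the operator norm
    because both laws fix its value. *)
Lemma norm2_mulmx {k d} (M : 'M[R]_(k, d)) (x : 'cV[R]_d) :
  norm2 (M *m x) <= Num.sqrt (\sum_i \sum_j M i j ^+ 2) * norm2 x.
Proof.
have F0 : 0 <= \sum_i \sum_j M i j ^+ 2.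
  by apply: sumr_ge0 => i _; apply: sumr_ge0 => j _; exact: sqr_ge0.
rewrite -(@ler_pXn2r _ 2)// ?nnegrE ?mulr_ge0 ?norm2_ge0 ?sqrtr_ge0//.
rewrite exprMn !sqr_norm2 sqr_sqrtr// mulr_suml ler_sum// => i _.
by rewrite mxE Cauchy_Schwarz_sum.
Qed.

Lemma norm2_mulmx_continuous {k d} (z : 'cV[R]_d) :
  continuous (fun M : 'M[R]_(k, d) => norm2 (M *m z)).
Proof.
have coord i : continuous (fun M : 'M[R]_(k, d) => (M *m z) i ord0).
  rewrite (_ : (fun _ => _) = fun M : 'M[R]_(k, d) => \sum_j M i j * z j ord0).
    apply: continuous_big => [|j _ M]; first exact: add_continuous.
    by apply: continuousM; [exact: coord_continuous|exact: cst_continuous].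
  by apply/funext => M; rewrite mxE.
move=> M; apply: (@continuous_comp _ _ _
  (fun M : 'M[R]_(k, d) => \sum_i (M *m z) i ord0 ^+ 2) Num.sqrt);
  last exact: sqrt_continuous.
apply: continuous_big => [|i _ A]; first exact: add_continuous.
by apply: continuousM; exact: coord.
Qed.

Lemma closed_weak_JL {k d} eps delta (z : 'cV[R]_d) :
  closed [set M : 'M[R]_(k, d) | weak_JL eps delta M z].
Proof.
have cle c : closed [set M : 'M[R]_(k, d) | norm2 (M *m z) <= c].
  apply: (iffLR (continuous_closedP _) (norm2_mulmx_continuous z)
                [set x | x <= c]).
  exact: closed_le.
have cge c : closed [set M : 'M[R]_(k, d) | c <= norm2 (M *m z)].
  apply: (iffLR (continuous_closedP _) (norm2_mulmx_continuous z)
                [set x | c <= x]).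
  exact: closed_ge.
rewrite (_ : [set _ | _] = ([set M : 'M[R]_(k, d) | (1 - eps) * norm2 z <= norm2 (M *m z)]
    `&` [set M | norm2 (M *m z) <= (1 + eps) * norm2 z])
    `|` ([set _ | norm2 z <= delta] `&` [set M | norm2 (M *m z) <= delta])).
  apply: closedU; first exact: closedI.
  apply: closedI => //.
  (* This condition does not involve the matrix, so it cuts out everything or nothing. *)
  have [h|h] := pselect (norm2 z <= delta).
    by rewrite (_ : [set _ | _] = setT); [exact: closedT|apply/seteqP; split].
  by rewrite (_ : [set _ | _] = set0); [exact: closed0|apply/seteqP; split].
apply/seteqP; split => M /=.
  by move=> [/andP[]|[]]; [left|right].
by move=> [[h1 h2]|[]]; [left; apply/andP|right].
Qed.

(** With [h = norm2 (x - z)] and [s = sqrt d], passing from [z] to [x] moves the norm by at most [h]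
    and the norm of the image by at most [s * h]. As [1 + eps / 2 <= 2], this gives [norm2 (M *m x)
    <= (1 + eps / 2) * norm2 x + (s + 2) * h], and similarly from below. *)
Lemma weak_JL_near {k d} {eps delta : R} {M : 'M[R]_(k, d)} {x z : 'cV[R]_d} :
  0 < delta -> 0 < eps -> eps < 1 ->
  \sum_i \sum_j M i j ^+ 2 = d%:R ->
  norm2 (x - z) * (Num.sqrt d%:R + 2) <= delta * eps / 4 ->
  strong_JL (eps / 2) M z -> weak_JL eps delta M x.
Proof.
move=> d0 e0 e1 FM xz /andP[lo hi].
have := norm2_mulmx M (x - z); rewrite FM mulmxBr => Mxz.
have tri n (u v : 'cV[R]_n) : norm2 u <= norm2 v + norm2 (u - v).
  by rewrite -{1}(subrK v u) addrC norm2D.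
have nC n (u v : 'cV[R]_n) : norm2 (v - u) = norm2 (u - v).
  by rewrite -norm2N opprB.
have t1 := tri _ x z.
have t2 := tri _ z x; rewrite nC in t2.
have t3 := tri _ (M *m x) (M *m z).
have t4 := tri _ (M *m z) (M *m x); rewrite nC in t4.
have h0 := norm2_ge0 (x - z).
have x0 := norm2_ge0 x.
move: (sqrtr_ge0 (d%:R : R)) => s0.
set s := Num.sqrt _ in s0 xz Mxz.
set h := norm2 (x - z) in h0 xz Mxz t1 t2.
(* For large [x], [(s + 2) * h <= eps / 2 * norm2 x]. For small [x], the image has norm at most [(1
   + eps / 2) * delta / 2 + delta * eps / 4], which is below [delta]. *)
case: (leP (delta / 2) (norm2 x)) => hx; [left; apply/andP; split|right; split].
- nra.
- nra.
- nra.
- nra.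
Qed.

(** The constant given by [lipschitz01] bounds the difference quotients, so their supremum is a
    genuine upper bound; the diagonal [t = s] has no quotient and is treated apart. *)
Lemma lipschitz_constP {d} {phi : R -> 'cV[R]_d} : lipschitz01 phi ->
  forall t s, 0 <= t <= 1 -> 0 <= s <= 1 ->
  norm2 (phi t - phi s) <= lipschitz_const phi * `|t - s|.
Proof.
move=> [L HL] t s t01 s01; have [->|ts] := eqVneq t s.
  by rewrite !subrr norm2_0 normr0 mulr0.
rewrite -ler_pdivrMr ?normr_gt0 ?subr_eq0//.
apply: ub_le_sup; last by exists t, s.
exists L => _ [u [v [u01 v01 uv ->]]].
by rewrite ler_pdivrMr ?normr_gt0 ?subr_eq0//; exact: HL.
Qed.

Lemma lipschitz_const_ge0 {d} {phi : R -> 'cV[R]_d} :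
  lipschitz01 phi -> 0 <= lipschitz_const phi.
Proof.
move=> /lipschitz_constP /(_ 1 0); rewrite lexx ler01/= lexx subr0 normr1 mulr1.
by move=> /(_ isT isT); exact/le_trans/norm2_ge0.
Qed.

End norm2.

Lemma unit_interval_grid {R : realType} {N : nat} {t : R} :
  (0 < N)%N -> 0 <= t <= 1 ->
  exists i : 'I_N, `|t - i%:R / N%:R| <= N%:R^-1.
Proof.
move=> N0 /andP[t0 t1].
have N0' : 0 < N%:R :> R by rewrite ltr0n.
have tN0 : 0 <= t * N%:R by rewrite mulr_ge0// ltW.
suff [i /andP[h1 h2]] : exists i : 'I_N, i%:R <= t * N%:R <= i%:R + 1.
  exists i; rewrite -(@ler_pM2r _ N%:R)// mulVf ?gt_eqF//.
  rewrite -{2}(gtr0_norm N0') -normrM mulrBl divfK ?gt_eqF// ger0_norm; lra.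
have /andP[h1 h2] := truncn_itv tN0.
have [lt_iN|le_Ni] := ltnP (Num.truncn (t * N%:R)) N.
  by exists (Ordinal lt_iN); rewrite /= h1 natr1 ltW.
(* Only [t = 1] gets here: its truncation is [N], one past the last index, so the index [N - 1] is
   taken, at distance exactly [1 / N]. *)
case: N N0 N0' tN0 h1 h2 le_Ni => // n _ N0' tN0 h1 h2 le_Ni.
exists ord_max; apply/andP; split; last by rewrite /= natr1 ler_piMl// ltW.
by rewrite /= (le_trans _ h1)// ler_nat ltnW.
Qed.

Section random_matrix.
Context {R : realType} {disp : measure_display} {T : measurableType disp}.
Context (P : probability T R) {k d : nat} (M : {RV P >-> mxBorel R k d}).

Lemma measurable_closed_RV (C : set 'M[R]_(k, d)) :
  closed C -> measurable [set w | C (M w)].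
Proof.
move=> clC; rewrite -[X in measurable X]setTI.
apply: (measurable_funP M measurableT).
rewrite -[X in measurable X]setCK; apply: measurableC.
by apply: sub_sigma_algebra; exact: closed_openC.
Qed.

Lemma measurable_coord_eq i j c :
  measurable [set w | (M w : 'M[R]_(k, d)) i j = c].
Proof.
apply: (@measurable_closed_RV [set A | A i j = c]).
apply: (iffLR (continuous_closedP _) (@coord_continuous R k d i j) [set c]).
exact: closed_eq.
Qed.

(** Almost surely each of the [k * d] entries has square [1 / k]. *)
Lemma ae_sign_matrix_frobenius : (0 < k)%N -> random_sign_matrix M ->
  {ae P, forall w, \sum_i \sum_j (M w : 'M[R]_(k, d)) i j ^+ 2 = d%:R}.
Proof.
move=> k0 [_ HM].
have c0 : 0 < (Num.sqrt k%:R)^-1 :> R by rewrite invr_gt0 sqrtr_gt0 ltr0n.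
have coord (i : 'I_k) (j : 'I_d) :
    {ae P, forall w, (M w : 'M[R]_(k, d)) i j ^+ 2 = k%:R^-1}.
  have [Pp Pm] := HM i j.
  set A := [set w | _] in Pp; set B := [set w | _] in Pm.
  have mA : measurable A by exact: measurable_coord_eq.
  have mB : measurable B by exact: measurable_coord_eq.
  (* The two values are distinct since [1 / sqrt k] is positive, so their probabilities add up. *)
  have PAB : P (A `|` B) = 1%E.
    rewrite measureU//.
      by rewrite [X in (X + _)%E]Pp [X in (_ + X)%E]Pm -EFinD; congr EFin; lra.
    apply/seteqP; split => // w []; rewrite /A /B /= => ->; lra.
  apply: (@negligibleS _ _ _ _ (~` (A `|` B))).
    apply: subsetC => w []/= ->;
      by rewrite ?sqrrN exprVn sqr_sqrtr.
  have mAB : measurable (A `|` B) by exact: measurableU.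
  apply/negligibleP; first exact: measurableC.
  by apply: etrans (probability_setC P mAB) _; rewrite PAB subee.
have : {ae P, forall w (ij : 'I_k * 'I_d),
    (M w : 'M[R]_(k, d)) ij.1 ij.2 ^+ 2 = k%:R^-1}.
  (* There are finitely many entries, so one null set serves them all. *)
  by apply: filter_forall => -[i j]; exact: coord.
apply: filterS => w Hw.
under eq_bigr do under eq_bigr => j _ do rewrite (Hw (_, j)).
rewrite !sumr_const !card_ord -mulrnA mulnC mulrnA -[_ *+ k]mulr_natr mulVf//.
by rewrite pnatr_eq0 -lt0n.
Qed.

(** The sum is the trace of [M *m M^T], that is [d / k] times the trace of the identity of size
    [k]. *)
Lemma ae_projection_frobenius : (0 < k)%N -> scaled_random_projection M ->
  {ae P, forall w, \sum_i \sum_j (M w : 'M[R]_(k, d)) i j ^+ 2 = d%:R}.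
Proof.
move=> k0 [Q [[HQ _] HM]]; apply: filterS HQ => w Qw.
transitivity (\tr ((M w : 'M[R]_(k, d)) *m (M w : 'M[R]_(k, d))^T)).
  apply: eq_bigr => i _; rewrite mxE; apply: eq_bigr => j _.
  by rewrite mxE expr2.
rewrite HM linearZ/= -scalemxAl -scalemxAr scalerA Qw mxtraceZ mxtrace1.
by rewrite -expr2 sqr_sqrtr ?divr_ge0// divfK// pnatr_eq0 -lt0n.
Qed.

End random_matrix.

Theorem lemma2p4 (R : realType) (disp : measure_display)
  (T : measurableType disp) (P : probability T R)
  (d k N : nat) (phi : R -> 'cV[R]_d) (delta eps p : R)
  (M : {RV P >-> mxBorel R k d})
  (phi_lip : lipschitz01 phi)
  (delta_gt0 : 0 < delta)
  (eps_gt0 : 0 < eps) (eps_lt1 : eps < 1)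
  (N_gt0 : (0 < N)%N)
  (N_ge : 4 * (lipschitz_const phi * (Num.sqrt d%:R + 2) / (delta * eps))
            <= N%:R)
  (k_gt0 : (0 < k)%N) (k_le_d : (k <= d)%N)
  (M_law : random_sign_matrix M \/ scaled_random_projection M)
  (p_ge0 : 0 <= p) (p_le1 : p <= 1)
  (JL : forall z : 'I_N -> 'cV[R]_d,
     with_prob_ge P p
       [set w | forall i : 'I_N, strong_JL (eps / 2) (M w : 'M[R]_(k, d)) (z i)]) :
  with_prob_ge P p
    [set w | forall t : R, 0 <= t <= 1 ->
       weak_JL eps delta (M w : 'M[R]_(k, d)) (phi t)].
Proof.
have mE : measurable [set w | forall t : R, 0 <= t <= 1 ->
    weak_JL eps delta (M w : 'M[R]_(k, d)) (phi t)].
  (* Closed sets are stable under arbitrary intersections, so the uncountable range of [t] is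
     harmless. *)
  apply: (@measurable_closed_RV _ _ _ P _ _ M
    (\bigcap_(t in [set t : R | 0 <= t <= 1])
      [set A : 'M[R]_(k, d) | weak_JL eps delta A (phi t)])).
  by apply: closed_bigI => t _; exact: closed_weak_JL.
split=> //.
have frob : {ae P, forall w, \sum_i \sum_j (M w : 'M[R]_(k, d)) i j ^+ 2 = d%:R}.
  by case: M_law; [exact: ae_sign_matrix_frobenius
                  |exact: ae_projection_frobenius].
have [mJ PJ] := JL (fun i => phi (i%:R / N%:R)).
apply: (le_trans PJ).
have [Z [mZ PZ frobZ]] := frob.
(* The grid event lies in the target event only up to the null set [Z] where the Frobenius norm may
   be wrong; adding [P Z = 0] on the right absorbs it. *)
rewrite -[leRHS]adde0 -[X in (_ <= _ + X)%E]PZ.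
apply: le_trans (measureU2 _ mE mZ).
apply: le_measure; rewrite ?inE//; first exact: measurableU.
move=> w Jw; have [Zw|nZw] := pselect (Z w); [by right|left].
have Fw : \sum_i \sum_j (M w : 'M[R]_(k, d)) i j ^+ 2 = d%:R.
  by apply: contrapT => nF; apply: nZw; exact: frobZ.
move=> t t01; have [i ti] := unit_interval_grid N_gt0 t01.
apply: (weak_JL_near delta_gt0 eps_gt0 eps_lt1 Fw _ (Jw i)).
have N0 : 0 < N%:R :> R by rewrite ltr0n.
have i01 : 0 <= (i%:R / N%:R : R) <= 1.
  by rewrite divr_ge0//= ler_pdivrMr// mul1r ler_nat ltnW.
have L0 := lipschitz_const_ge0 phi_lip.
have s0 := sqrtr_ge0 (d%:R : R).
have de0 : 0 < delta * eps by rewrite mulr_gt0.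
apply: (@le_trans _ _ (lipschitz_const phi * N%:R^-1 * (Num.sqrt d%:R + 2))).
  apply: ler_wpM2r; first by rewrite addr_ge0.
  by apply: le_trans (lipschitz_constP phi_lip _ _ t01 i01) _; exact: ler_wpM2l.
(* Cleared of denominators, the bound on [N] is exactly the closeness that [weak_JL_near] requires
   of the grid point. *)
move: N_ge; rewrite !mulrA ler_pdivrMr// => H.
rewrite ler_pdivlMr// -(@ler_pM2r _ N%:R)//.
rewrite (_ : _ * 4 * _ = 4 * lipschitz_const phi * (Num.sqrt d%:R + 2)); first lra.
by field; rewrite gt_eqF.
Qed.
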